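(* Let $K$ be a field, $R=K[x_1,\dots,x_n]$, $T=K[y_1,\dots,y_m]$ and $S=R\otimes_K T=K[x_1,\dots,x_n,y_1,\dots,y_m]$. Let $I\subset R$ and $J\subset T$ be proper monomial ideals, whose extensions to $S$ are again denoted by $I$ and $J$. Let $k\ge1$, and let $\mathfrak{p}\in\operatorname{Spec}(R)$ and $\mathfrak{q}\in\operatorname{Spec}(T)$ be monomial prime ideals such that $\mathfrak{p}+\mathfrak{q}\in\operatorname{Ass}((I+J)^k)$. Then $$\mathrm{v}_{\mathfrak{p}+\mathfrak{q}}((I+J)^k)\ =\ \min_{\substack{0\le\ell<k\\ \mathfrak{p}\in\operatorname{Ass}(I^{k-\ell})\\ \mathfrak{q}\in\operatorname{Ass}(J^{\ell+1})}}\bigl(\mathrm{v}_{\mathfrak{p}}(I^{k-\ell})+\mathrm{v}_{\mathfrak{q}}(J^{\ell+1})\bigr),$$ where the minimum is over all integers $\ell$ with $0\le\ell<k$, $\mathfrak{p}\in\operatorname{Ass}(I^{k-\ell})$ and $\mathfrak{q}\in\operatorname{Ass}(J^{\ell+1})$.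
   Context: Polynomial rings are standard graded. For an ideal $L$ of a polynomial ring $S$, $\operatorname{Ass}(L)$ denotes the set of associated primes of $S/L$. Ideals and primes of $R$ and of $T$ are identified with their extensions to $S$; $\mathfrak{p}+\mathfrak{q}$ means $\mathfrak{p}S+\mathfrak{q}S$. A monomial prime ideal is an ideal generated by a subset of the variables. For a graded ideal $L$ and $P\in\operatorname{Ass}(L)$, $\mathrm{v}_{P}(L)$ is the least degree of a homogeneous polynomial $f$ such that $(L:f)=P$.
   Formalization: For k ≥ 2 the formal theorem also assumes that I = 0 if and only if J = 0; without this the formula fails, e.g. for I = 0, J = (y), k = 2, p = 0, q = (y), where the left side is 1 and the right side is 0. *)

(* Defs.v *)
From mathcomp Require Import all_boot all_order all_algebra.
From mathcomp Require Import boolp classical_sets.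
From mathcomp Require Import mpoly.

Set Implicit Arguments.
Unset Strict Implicit.
Unset Printing Implicit Defensive.

Import Order.TTheory GRing.Theory.

Local Open Scope classical_set_scope.
Local Open Scope ring_scope.

(* mathcomp's [idealr_closed] only covers proper ideals; the unit ideal has to
   be allowed here, since colon ideals and powers may be improper. *)
Definition is_ideal (A : comNzRingType) (L : set A) : Prop :=
  [/\ L 0, (forall a b, L a -> L b -> L (a + b))
    & (forall c a, L a -> L (c * a))].

Definition gen_ideal (A : comNzRingType) (G : set A) : set A :=
  smallest (@is_ideal A) G.

Definition prime_ideal (A : comNzRingType) (P : set A) : Prop :=
  idealr_closed (mem P) /\ prime_idealr_closed (mem P).

Definition add_ideal (A : comNzRingType) (L M : set A) : set A :=
  [set a + b | a in L & b in M].

Definition mul_ideal (A : comNzRingType) (L M : set A) : set A :=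
  gen_ideal [set a * b | a in L & b in M].

Definition exp_ideal (A : comNzRingType) (L : set A) (k : nat) : set A :=
  iter k (mul_ideal L) setT.

Definition colon (A : comNzRingType) (L : set A) (f : A) : set A :=
  [set g | L (g * f)].

(* P is associated to A/L: it is prime and the annihilator of a class f + L. *)
Definition Ass (A : comNzRingType) (L : set A) : set (set A) :=
  [set P | prime_ideal P /\ exists f : A, colon L f = P].

Definition monomial_ideal (K : fieldType) (n : nat) (L : set {mpoly K[n]}) :
    Prop :=
  exists G : set 'X_{1..n}, L = gen_ideal [set 'X_[u] | u in G].

Definition monomial_prime (K : fieldType) (n : nat) (P : set {mpoly K[n]}) :
    Prop :=
  prime_ideal P /\
  exists V : {set 'I_n}, P = gen_ideal [set 'X_i | i in [set` V]].

Definition is_minimum (D : set nat) (d : nat) : Prop := D d /\ lbound D d.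

(* For P in Ass L with L and P graded the set below is nonempty; otherwise the
   value may be the default 0.  The zero polynomial is homogeneous of every
   degree, but colon L 0 is the unit ideal, hence never prime. *)
Definition vnumber (K : fieldType) (n : nat) (L P : set {mpoly K[n]}) : nat :=
  xget 0%N (is_minimum
    [set d | exists f : {mpoly K[n]}, f \is d.-homog /\ colon L f = P]).

(* In K[x_1..x_n, y_1..y_m] = {mpoly K[n + m]} the first n variables are the
   x's and the last m ones the y's. *)
Definition incl_x (K : fieldType) (n m : nat) (f : {mpoly K[n]}) :
    {mpoly K[n + m]} :=
  f \mPo [tuple 'X_(lshift m i) | i < n].

Definition incl_y (K : fieldType) (n m : nat) (g : {mpoly K[m]}) :
    {mpoly K[n + m]} :=
  g \mPo [tuple 'X_(rshift n j) | j < m].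

Definition ext_x (K : fieldType) (n m : nat) (L : set {mpoly K[n]}) :
    set {mpoly K[n + m]} :=
  gen_ideal (@incl_x K n m @` L).

Arguments ext_x {K n} m L.

Definition ext_y (K : fieldType) (n m : nat) (L : set {mpoly K[m]}) :
    set {mpoly K[n + m]} :=
  gen_ideal (@incl_y K n m @` L).

Arguments ext_y {K} n {m} L.

(* Main.v *)
(* A monomial ideal is determined by its up-set of monomials, and a colon ideal
   (L : f) that is a monomial prime already equals (L : u) for some monomial u of
   f; call u a witness.  Let I^i and J^j also denote the monomials they contain.
   If x^a y^b is a witness of p + q for (I + J)^k, let l be the largest exponent
   such that y^b z is in J^l for some monomial z outside q.  Since (I + J)^k is
   the sum of the I^i J^(k - i), x^a is a witness of p for I^(k - l) and y^b a
   witness of q for J^(l + 1).  Conversely, witnesses x^a and y^b of these kinds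
   give the witness x^a y^b: the only point is that y^b is in J^l and x^a in
   I^(k - l - 1).  If q contains a variable y_j, this holds for y^b because
   y^b y_j in J^(l + 1) implies y^b in J^l; if q = 0 then J = 0, and k = 1 or
   I = 0.  The case of x^a is the same. *)
Require Import Defs.
From mathcomp Require Import all_boot all_order all_algebra.
From mathcomp Require Import boolp classical_sets.
From mathcomp Require Import mpoly.

Set Implicit Arguments.
Unset Strict Implicit.
Unset Printing Implicit Defensive.

Import GRing.Theory.

Local Open Scope classical_set_scope.
Local Open Scope ring_scope.

(** * Monomial ideals and their powers as up-sets of exponents *)

Definition upset (n : nat) (A : set 'X_{1..n}) : Prop :=
  forall u v : 'X_{1..n}, A u -> A (u + v)%MM.

Definition msum (n : nat) (A B : set 'X_{1..n}) : set 'X_{1..n} :=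
  [set (u + v)%MM | u in A & v in B].

(** Starting from [setT] makes the power 0 the unit ideal and every power an up-set, whatever [A]
    is. *)
Definition mpow (n : nat) (A : set 'X_{1..n}) (k : nat) : set 'X_{1..n} :=
  iter k (msum A) setT.

Definition mspan (K : fieldType) (n : nat) (A : set 'X_{1..n}) :
    set {mpoly K[n]} :=
  [set f | forall u, u \in msupp f -> A u].

Arguments mspan K {n} A.

(** The exponents of the monomials in the prime generated by the variables in [V]. *)
Definition meets (n : nat) (V : {set 'I_n}) : set 'X_{1..n} :=
  [set u | exists2 i, i \in V & u i != 0%N].

Lemma gen_ideal_is_ideal (R : comNzRingType) (G : set R) :
  is_ideal (gen_ideal G).
Proof.
split; first by move=> L [[L0 _ _] _].
- move=> a b Ga Gb L [Lid GL]; case: (Lid) => _ addL _.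
  by apply: addL; [apply: Ga | apply: Gb].
- move=> c a Ga L [Lid GL]; case: (Lid) => _ _ mulL.
  by apply: mulL; apply: Ga.
Qed.

Lemma gen_ideal_mulr (R : comNzRingType) (G : set R) (c g : R) :
  G g -> gen_ideal G (c * g).
Proof. by move=> Gg L [[_ _ mulL] GL]; apply/mulL/GL. Qed.

Lemma mspanX (K : fieldType) (n : nat) (A : set 'X_{1..n}) (u : 'X_{1..n}) :
  mspan K A 'X_[u] <-> A u.
Proof.
split=> [|Au v]; first by apply; rewrite msuppX inE.
by rewrite msuppX inE => /eqP ->.
Qed.

Lemma mspan_eq0 (K : fieldType) (n : nat) (A : set 'X_{1..n}) :
  mspan K A = [set 0] <-> A = set0.
Proof.
split=> [A0 | ->].
  apply/seteqP; split=> u // /(mspanX K); rewrite A0 /= => /(congr1 (mcoeff u)) /eqP.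
  by rewrite mcoeffX mcoeff0 eqxx oner_eq0.
apply/seteqP; split=> f /=; last by move=> -> u; rewrite msupp0.
move=> f0; apply: msuppnil0; case eqs: (msupp f : seq _) => [//|u s].
by have [] := f0 u; rewrite eqs mem_head.
Qed.

Lemma mspan_is_ideal (K : fieldType) (n : nat) (A : set 'X_{1..n}) :
  upset A -> is_ideal (mspan K A).
Proof.
move=> upA; split=> [u|f g Lf Lg u|f g Lg u]; first by rewrite msupp0.
- by move/msuppD_le; rewrite mem_cat => /orP[/Lf|/Lg].
- move/msuppM_le/allpairsP=> [[v w] /= [_ /Lg Aw ->]].
  by rewrite addmC; apply: upA.
Qed.

Lemma mspan_sub_ideal (K : fieldType) (n : nat) (A : set 'X_{1..n})
    (L : set {mpoly K[n]}) :
  is_ideal L -> (forall u, A u -> L 'X_[u]) -> mspan K A `<=` L.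
Proof.
move=> [L0 addL mulL] AL f Lf; rewrite [f]mpolyE big_seq.
elim/big_ind: _ => // u /Lf /AL Lu.
by rewrite -mul_mpolyC; apply: mulL.
Qed.

Lemma gen_ideal_mspan (K : fieldType) (n : nat) (A : set 'X_{1..n})
    (G : set {mpoly K[n]}) :
  upset A -> G `<=` mspan K A -> (forall u, A u -> gen_ideal G 'X_[u]) ->
  gen_ideal G = mspan K A.
Proof.
move=> upA GA AG; apply/seteqP; split.
  by apply: smallest_sub => //; apply: mspan_is_ideal.
by apply: mspan_sub_ideal => //; apply: gen_ideal_is_ideal.
Qed.

Lemma upset_msum (n : nat) (A B : set 'X_{1..n}) : upset B -> upset (msum A B).
Proof.
move=> upB _ w [u Au [v Bv <-]]; exists u => //; exists (v + w)%MM; first exact: upB.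
by rewrite addmA.
Qed.

Lemma upset_mpow (n : nat) (A : set 'X_{1..n}) (k : nat) : upset (mpow A k).
Proof. by elim: k => [|k IH] //=; apply: upset_msum. Qed.

Lemma upset_meets (n : nat) (V : {set 'I_n}) : upset (meets V).
Proof.
move=> u v [i iV ui]; exists i => //.
by rewrite mnmDE addn_eq0 negb_and ui.
Qed.

Lemma mpowS (n : nat) (A : set 'X_{1..n}) (k : nat) (u v : 'X_{1..n}) :
  A u -> mpow A k v -> mpow A k.+1 (u + v)%MM.
Proof. by move=> Au Av; exists u => //; exists v. Qed.

Lemma mpow_le (n : nat) (A : set 'X_{1..n}) (k l : nat) :
  (k <= l)%N -> mpow A l `<=` mpow A k.
Proof.
elim: k l => [|k IH] [|l] // kl _ [u Au [v Av <-]].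
by apply: mpowS => //; apply: IH Av.
Qed.

Lemma mpow_nonempty (n : nat) (A : set 'X_{1..n}) (k : nat) (u : 'X_{1..n}) :
  (0 < k)%N -> mpow A k u -> A !=set0.
Proof. by case: k => // k _ [v Av _]; exists v. Qed.

(** Removing one variable from a multiple of a product of [k + 1] elements of [A] spoils at most one
    factor; the other [k] still divide what remains. *)
Lemma mpow_pred (n : nat) (A : set 'X_{1..n}) (k : nat) (u : 'X_{1..n})
    (i : 'I_n) :
  upset A -> mpow A k.+1 (u + U_(i))%MM -> mpow A k u.
Proof.
move=> upA; elim: k u => [|k IH] // u [c Ac [d Ad eq_cd]].
have eqj j : (c j + d j = u j + (i == j))%N.
  by have /mnmP/(_ j) := eq_cd; rewrite !mnmDE mnm1E.
(* If [d] does not involve the variable, then [d] divides [u]; otherwise the variable is removed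
   from [d] by induction. *)
have [d0|d0] := eqVneq (d i) 0%N.
  have -> : u = (d + (u - d))%MM.
    apply/mnmP => j; rewrite mnmDE mnmBE subnKC //.
    have := eqj j; case: (eqVneq i j) => [<- _|_]; first by rewrite d0.
    by rewrite addn0 => <-; apply: leq_addl.
  exact: upset_mpow.
have eqd : d = (d - U_(i) + U_(i))%MM by rewrite submK // lep1mP.
have -> : u = (c + (d - U_(i)))%MM.
  by apply: (@addIm _ U_(i)%MM); rewrite -addmA -eqd.
by apply: mpowS => //; apply: IH; rewrite -eqd.
Qed.

Lemma mul_mspan (K : fieldType) (n : nat) (A B : set 'X_{1..n}) :
  upset B -> mul_ideal (mspan K A) (mspan K B) = mspan K (msum A B).
Proof.
move=> upB; apply: gen_ideal_mspan; first exact: upset_msum.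
  move=> _ [f Af [g Bg <-]] u /msuppM_le/allpairsP[[v w] /= [/Af Av /Bg Bw ->]].
  by exists v => //; exists w.
move=> _ [u Au [v Bv <-]] L [_]; apply.
exists 'X_[u]; first exact/mspanX.
by exists 'X_[v]; [exact/mspanX | rewrite mpolyXD].
Qed.

Lemma exp_mspan (K : fieldType) (n : nat) (A : set 'X_{1..n}) (k : nat) :
  exp_ideal (mspan K A) k = mspan K (mpow A k).
Proof.
elim: k => [|k IH]; first by apply/seteqP; split.
by rewrite /exp_ideal iterS -/(exp_ideal _ _) IH mul_mspan //; apply: upset_mpow.
Qed.

Lemma add_mspan (K : fieldType) (n : nat) (A B : set 'X_{1..n}) :
  upset A -> upset B ->
  add_ideal (mspan K A) (mspan K B) = mspan K (A `|` B).
Proof.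
move=> upA upB; have upAB : upset (A `|` B).
  by move=> u v [/upA|/upB] H; [left|right].
have [A0 addA mulA] := mspan_is_ideal K upA.
have [B0 addB mulB] := mspan_is_ideal K upB.
apply/seteqP; split.
  move=> _ [f Af [g Bg <-]] u /msuppD_le; rewrite mem_cat.
  by case/orP=> [/Af|/Bg] ?; [left|right].
apply: mspan_sub_ideal; last first.
  move=> u [Au|Bu].
    by exists 'X_[u]; [exact/mspanX | exists 0 => //; rewrite addr0].
  by exists 0 => //; exists 'X_[u]; [exact/mspanX | rewrite add0r].
split; first by exists 0 => //; exists 0 => //; rewrite addr0.
- move=> _ _ [f Af [g Bg <-]] [f' Af' [g' Bg' <-]].
  by exists (f + f'); [exact: addA | exists (g + g'); [exact: addB | rewrite addrACA]].
- move=> c _ [f Af [g Bg <-]].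
  by exists (c * f); [exact: mulA | exists (c * g); [exact: mulB | rewrite mulrDr]].
Qed.

Lemma monomial_idealP (K : fieldType) (n : nat) (L : set {mpoly K[n]}) :
  monomial_ideal L -> exists2 A, upset A & L = mspan K A.
Proof.
(* [msum G setT] is the up-set generated by [G]. *)
move=> [G ->]; exists (msum G setT); first exact: upset_msum.
apply: gen_ideal_mspan; first exact: upset_msum.
  move=> _ [u Gu <-]; apply/mspanX; exists u => //.
  by exists 0%MM => //; rewrite addm0.
move=> _ [u Gu [v _ <-]]; rewrite addmC mpolyXD.
by apply: gen_ideal_mulr; exists u.
Qed.

Lemma monomial_primeP (K : fieldType) (n : nat) (P : set {mpoly K[n]}) :
  monomial_prime P -> exists V, P = mspan K (meets V).
Proof.
move=> [_ [V ->]]; exists V; apply: gen_ideal_mspan; first exact: upset_meets.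
  by move=> _ [i iV <-]; apply/mspanX; exists i => //; rewrite mnm1E eqxx.
move=> u [i iV ui].
have -> : u = (u - U_(i) + U_(i))%MM by rewrite submK // lep1mP.
rewrite mpolyXD.
by apply: gen_ideal_mulr; exists i.
Qed.

(** * Splitting monomials into x-part and y-part; extended ideals *)

Definition mfst (n m : nat) (w : 'X_{1..n + m}) : 'X_{1..n} :=
  [multinom w (lshift m i) | i < n].

Definition msnd (n m : nat) (w : 'X_{1..n + m}) : 'X_{1..m} :=
  [multinom w (rshift n j) | j < m].

Definition mcat (n m : nat) (u : 'X_{1..n}) (v : 'X_{1..m}) : 'X_{1..n + m} :=
  [multinom match split i with inl a => u a | inr b => v b end | i < n + m].

Lemma mcat_lshift (n m : nat) (u : 'X_{1..n}) (v : 'X_{1..m}) (i : 'I_n) :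
  mcat u v (lshift m i) = u i.
Proof. by rewrite mnmE -[lshift m i]/(unsplit (inl i)) unsplitK. Qed.

Lemma mcat_rshift (n m : nat) (u : 'X_{1..n}) (v : 'X_{1..m}) (j : 'I_m) :
  mcat u v (rshift n j) = v j.
Proof. by rewrite mnmE -[rshift n j]/(unsplit (inr j)) unsplitK. Qed.

Lemma mfst_mcat (n m : nat) (u : 'X_{1..n}) (v : 'X_{1..m}) :
  mfst (mcat u v) = u.
Proof. by apply/mnmP => i; rewrite mnmE mcat_lshift. Qed.

Lemma msnd_mcat (n m : nat) (u : 'X_{1..n}) (v : 'X_{1..m}) :
  msnd (mcat u v) = v.
Proof. by apply/mnmP => i; rewrite mnmE mcat_rshift. Qed.

Lemma mcat_mfst_msnd (n m : nat) (w : 'X_{1..n + m}) :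
  mcat (mfst w) (msnd w) = w.
Proof.
apply/mnmP => i; rewrite -[i]splitK.
by case: (split i) => j /=; rewrite ?mcat_lshift ?mcat_rshift mnmE.
Qed.

Lemma mfstD (n m : nat) (w w' : 'X_{1..n + m}) :
  mfst (w + w') = (mfst w + mfst w')%MM.
Proof. by apply/mnmP => i; rewrite !mnmE. Qed.

Lemma msndD (n m : nat) (w w' : 'X_{1..n + m}) :
  msnd (w + w') = (msnd w + msnd w')%MM.
Proof. by apply/mnmP => i; rewrite !mnmE. Qed.

Lemma mcatD (n m : nat) (u u' : 'X_{1..n}) (v v' : 'X_{1..m}) :
  (mcat u v + mcat u' v')%MM = mcat (u + u') (v + v').
Proof.
by rewrite -[LHS]mcat_mfst_msnd mfstD msndD !mfst_mcat !msnd_mcat.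
Qed.

Lemma mdeg_mcat (n m : nat) (u : 'X_{1..n}) (v : 'X_{1..m}) :
  mdeg (mcat u v) = (mdeg u + mdeg v)%N.
Proof.
rewrite !mdegE big_split_ord /=; congr addn; apply: eq_bigr => i _.
  by rewrite mcat_lshift.
by rewrite mcat_rshift.
Qed.

Lemma incl_xX (K : fieldType) (n m : nat) (u : 'X_{1..n}) :
  incl_x m 'X_[K, u] = 'X_[mcat u 0%MM].
Proof.
rewrite /incl_x comp_mpolyX [RHS]mpolyXE_id big_split_ord /=.
rewrite [X in _ * X]big1 => [|j _]; last by rewrite mcat_rshift mnm0E expr0.
by rewrite mulr1; apply: eq_bigr => i _; rewrite tnth_mktuple mcat_lshift.
Qed.

Lemma incl_yX (K : fieldType) (n m : nat) (v : 'X_{1..m}) :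
  incl_y n 'X_[K, v] = 'X_[mcat 0%MM v].
Proof.
rewrite /incl_y comp_mpolyX [RHS]mpolyXE_id big_split_ord /=.
rewrite [X in X * _]big1 => [|j _]; last by rewrite mcat_lshift mnm0E expr0.
by rewrite mul1r; apply: eq_bigr => i _; rewrite tnth_mktuple mcat_rshift.
Qed.

(** The y-part of a monomial is a free cofactor, so membership in the extension depends on the
    x-part alone. *)
Lemma ext_x_mspan (K : fieldType) (n m : nat) (A : set 'X_{1..n}) :
  upset A -> ext_x m (mspan K A) = mspan K (@mfst n m @^-1` A).
Proof.
move=> upA.
have upA' : upset (@mfst n m @^-1` A) by move=> u v; rewrite /= mfstD; apply: upA.
have [A0 addA mulA] := mspan_is_ideal K upA'.
apply: gen_ideal_mspan => //.
  move=> _ [f Af <-]; rewrite /incl_x comp_mpolyEX big_seq.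
  elim/big_ind: _ => // u /Af Au; rewrite -mul_mpolyC; apply: mulA.
  by rewrite -/(incl_x _ _) incl_xX; apply/mspanX; rewrite /= mfst_mcat.
move=> u /= Au; rewrite -[u]mcat_mfst_msnd.
have -> : mcat (mfst u) (msnd u) = (mcat 0 (msnd u) + mcat (mfst u) 0)%MM.
  by rewrite mcatD add0m addm0.
rewrite mpolyXD -incl_xX.
by apply: gen_ideal_mulr; exists 'X_[mfst u] => //; apply/mspanX.
Qed.

Lemma ext_y_mspan (K : fieldType) (n m : nat) (B : set 'X_{1..m}) :
  upset B -> ext_y n (mspan K B) = mspan K (@msnd n m @^-1` B).
Proof.
move=> upB.
have upB' : upset (@msnd n m @^-1` B) by move=> u v; rewrite /= msndD; apply: upB.
have [B0 addB mulB] := mspan_is_ideal K upB'.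
apply: gen_ideal_mspan => //.
  move=> _ [f Bf <-]; rewrite /incl_y comp_mpolyEX big_seq.
  elim/big_ind: _ => // u /Bf Bu; rewrite -mul_mpolyC; apply: mulB.
  by rewrite -/(incl_y _ _) incl_yX; apply/mspanX; rewrite /= msnd_mcat.
move=> u /= Bu; rewrite -[u]mcat_mfst_msnd.
have -> : mcat (mfst u) (msnd u) = (mcat (mfst u) 0 + mcat 0 (msnd u))%MM.
  by rewrite mcatD add0m addm0.
rewrite mpolyXD -incl_yX.
by apply: gen_ideal_mulr; exists 'X_[msnd u] => //; apply/mspanX.
Qed.

(** * Monomial primes, witnesses and v-numbers *)

Definition mprime (n : nat) (M : set 'X_{1..n}) : Prop :=
  [/\ upset M, ~ M 0%MM & forall u v, M (u + v)%MM -> M u \/ M v].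

Lemma mprime_meets (n : nat) (V : {set 'I_n}) : mprime (meets V).
Proof.
split; first exact: upset_meets.
  by move=> [i _]; rewrite mnm0E.
move=> u v [i iV]; rewrite mnmDE addn_eq0 negb_and => /orP[ui|vi].
  by left; exists i.
by right; exists i.
Qed.

Lemma mprime_sum (n m : nat) (M : set 'X_{1..n}) (N : set 'X_{1..m}) :
  mprime M -> mprime N -> mprime (@mfst n m @^-1` M `|` @msnd n m @^-1` N).
Proof.
move=> [upM M0 sumM] [upN N0 sumN]; split.
- by move=> u v; rewrite /setU /= mfstD msndD => -[/upM|/upN] H; [left|right].
- rewrite /setU /=.
  have -> : @mfst n m 0%MM = 0%MM by apply/mnmP => i; rewrite !mnmE.
  have -> : @msnd n m 0%MM = 0%MM by apply/mnmP => i; rewrite !mnmE.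
  by case.
- move=> u v; rewrite /setU /= mfstD msndD => -[/sumM|/sumN] [] H; by tauto.
Qed.

Definition witness (n : nat) (A M : set 'X_{1..n}) (u : 'X_{1..n}) : Prop :=
  forall w, A (u + w)%MM <-> M w.

Lemma colon_mspanX (K : fieldType) (n : nat) (A : set 'X_{1..n})
    (u : 'X_{1..n}) :
  colon (mspan K A) 'X_[u] = mspan K [set w | A (u + w)%MM].
Proof.
apply/seteqP; split=> f /= Af w.
  move=> fw; apply: Af; rewrite (perm_mem (msuppMX _ _)); exact: map_f.
by rewrite (perm_mem (msuppMX _ _)) => /mapP[v /Af Av ->].
Qed.

Lemma colon_witness (K : fieldType) (n : nat) (A M : set 'X_{1..n})
    (u : 'X_{1..n}) :
  witness A M u -> colon (mspan K A) 'X_[u] = mspan K M.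
Proof.
move=> uW; rewrite colon_mspanX; congr mspan.
by apply/seteqP; split=> w /= /uW.
Qed.

(* If no monomial [u] of [f] were a witness, each would have a multiplier
   outside [M] sending it into [A]; the product of these multipliers is outside
   [M] and sends [f] into the ideal. *)
Lemma witness_colon (K : fieldType) (n : nat) (A M : set 'X_{1..n})
    (f : {mpoly K[n]}) :
  upset A -> mprime M -> colon (mspan K A) f = mspan K M ->
  exists2 u, u \in msupp f & witness A M u.
Proof.
move=> upA [upM M0 sumM] colf; apply: contrapT => noW.
have XM w : M w <-> mspan K A ('X_[w] * f).
  by rewrite -(mspanX K) -colf.
have suppX w u : u \in msupp ('X_[w] * f : {mpoly K[n]}) <->
    exists2 v, v \in msupp f & u = (w + v)%MM.
  rewrite mulrC (perm_mem (msuppMX _ _)); split=> [/mapP //|[v fv ->]].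
  exact: map_f.
have MA w u : u \in msupp f -> M w -> A (u + w)%MM.
  by move=> fu /XM; apply; apply/suppX; exists u => //; rewrite addmC.
have out u : u \in msupp f -> exists w, ~ M w /\ A (u + w)%MM.
  move=> fu; apply: contrapT => noout; apply: noW; exists u => // w.
  split=> [Auw|]; last exact: MA.
  by apply: contrapT => Mw; apply: noout; exists w.
have [w Mw Aw] : exists2 w, ~ M w & forall u, u \in msupp f -> A (u + w)%MM.
  elim: (msupp f : seq _) out => [|v s IH] out; first by exists 0%MM.
  have [u su|w Mw Aw] := IH; first by apply: out; rewrite inE su orbT.
  have [w' [Mw' Aw']] := out v (mem_head _ _).
  exists (w' + w)%MM; first by move=> /sumM[].
  move=> u; rewrite inE => /orP[/eqP -> | /Aw]; first by rewrite addmA; apply: upA.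
  by rewrite [(w' + w)%MM]addmC addmA; apply: upA.
by apply/Mw/XM => _ /suppX[v /Aw Av ->]; rewrite addmC.
Qed.

Lemma nat_minimum (D : set nat) : D !=set0 -> exists d, is_minimum D d.
Proof.
move=> [d Dd]; have exD : exists d, `[< D d >] by exists d; apply/asboolP.
case: (ex_minnP exD) => e /asboolP De minD; exists e; split=> // x Dx.
by apply: minD; apply/asboolP.
Qed.

(** A homogeneous [f] with colon ideal [mspan K M] has a witness among its monomials, of the same
    degree, and a witness is itself such an [f]; so only monomials need to be compared. *)
Lemma vnumber_witness (K : fieldType) (n : nat) (A M : set 'X_{1..n}) :
  upset A -> mprime M -> witness A M !=set0 ->
  is_minimum [set mdeg u | u in witness A M] (vnumber (mspan K A) (mspan K M)).
Proof.
move=> upA prM [u uW]; rewrite /vnumber.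
have -> : [set d | exists f : {mpoly K[n]},
    f \is d.-homog /\ colon (mspan K A) f = mspan K M] = mdeg @` witness A M.
  apply/seteqP; split=> [d [f [fd /(witness_colon upA prM) [v fv vW]]]|_ [v vW <-]].
    by exists v => //; apply: (dhomogP _ _ _ fd).
  exists 'X_[v]; split; last exact: colon_witness.
  by rewrite dhomogX eqxx.
(* Since a witness exists, [xget] returns a true minimum and not the default 0. *)
by apply: xgetPex; apply: nat_minimum; exists (mdeg u); exists u.
Qed.

(** * Witnesses for powers of a sum *)

(** Each of the [k] factors is counted through its x-part or its y-part; its other part is absorbed
    because powers are up-sets. *)
Lemma mpow_add (n m : nat) (A : set 'X_{1..n}) (B : set 'X_{1..m}) (k : nat)
    (u : 'X_{1..n}) (v : 'X_{1..m}) :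
  mpow (@mfst n m @^-1` A `|` @msnd n m @^-1` B) k (mcat u v) <->
  exists i j, [/\ (i + j)%N = k, mpow A i u & mpow B j v].
Proof.
split.
  elim: k u v => [|k IH] u v; first by exists 0%N, 0%N.
  move=> [c ABc [d ABd /[dup] /(congr1 (@mfst n m)) + /(congr1 (@msnd n m))]].
  rewrite mfstD msndD mfst_mcat msnd_mcat => <- <-.
  move: ABd; rewrite -[d in X in X -> _]mcat_mfst_msnd => /IH[i [j [<- Ai Bj]]].
  case: ABc => /= [Ac|Bc].
    exists i.+1, j; split; rewrite ?addSn //; first exact: mpowS.
    by rewrite addmC; apply: upset_mpow.
  exists i, j.+1; split; rewrite ?addnS //; last exact: mpowS.
  by rewrite addmC; apply: upset_mpow.
move=> [i [j [<-]]]; elim: i u v => [|i IH] u v.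
  move=> _; elim: j v => [|j IH] v //.
  move=> [c Bc [d Bd <-]]; rewrite -(add0m u) -mcatD.
  by apply: mpowS; [right; rewrite /= msnd_mcat | apply: IH].
move=> [c Ac [d Ad <-]] Bv; rewrite -(add0m v) -mcatD.
by apply: mpowS; [left; rewrite /= mfst_mcat | apply: IH].
Qed.

(* [l] is the largest exponent with [y^b z] in [J^l] for some monomial [z]
   outside [q]. *)
Lemma witness_split (n m : nat) (A M : set 'X_{1..n}) (B N : set 'X_{1..m})
    (k : nat) (a : 'X_{1..n}) (b : 'X_{1..m}) :
  ~ M 0%MM -> ~ N 0%MM ->
  witness (mpow (@mfst n m @^-1` A `|` @msnd n m @^-1` B) k)
          (@mfst n m @^-1` M `|` @msnd n m @^-1` N) (mcat a b) ->
  exists l, [/\ (l < k)%N, witness (mpow A (k - l)) M a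
              & witness (mpow B (l + 1)) N b].
Proof.
move=> M0 N0 abW.
have mixed w z : (exists i j, [/\ (i + j)%N = k, mpow A i (a + w)%MM
    & mpow B j (b + z)%MM]) <-> M w \/ N z.
  rewrite -mpow_add -mcatD; split=> [/abW|MN].
    by rewrite /setU /= mfst_mcat msnd_mcat.
  by apply/abW; rewrite /setU /= mfst_mcat msnd_mcat.
pose E t := `[< exists2 z, ~ N z & mpow B t (b + z)%MM >].
have E0 : exists t, E t by exists 0%N; apply/asboolP; exists 0%MM.
(* For [t >= k], the exponent [mcat a (b + z)] would lie in the [k]-th power, forcing [M 0] or
   [N z]. *)
have Elt t : E t -> (t < k)%N.
  move=> /asboolP[z Nz Bt]; rewrite ltnNge; apply/negP => kt.
  have [] : M 0%MM \/ N z; [|exact: M0|exact: Nz].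
  by apply/mixed; exists 0%N, k; split=> //; apply: mpow_le Bt.
have Ele t : E t -> (t <= k)%N by move/Elt/ltnW.
case: (ex_maxnP E0 Ele) => l El lmax; exists l.
have lk := Elt l El; move/asboolP: El => [z Nz Bl].
split=> // w; split.
(* The multiplier [z] supplies the missing power [l] of [B] while staying outside [N], so only [M w]
   is left. *)
- move=> Aw; have [//|//] : M w \/ N z.
  by apply/mixed; exists (k - l)%N, l; rewrite subnK // ltnW.
(* Maximality of [l], tested with the multiplier 0, gives [j <= l] and hence [i >= k - l]. *)
- move=> Mw; have /mixed[i [j [<- Ai Bj]]] : M w \/ N 0%MM by left.
  apply: mpow_le Ai; rewrite leq_subLR addnC leq_add2r.
  by apply: lmax; apply/asboolP; exists 0%MM.
- rewrite addn1 => Bw; apply: contrapT => Nw.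
  by have /lmax : E l.+1; [apply/asboolP; exists w | rewrite ltnn].
- move=> Nw; have /mixed[i [j [eqk Ai Bj]]] : M 0%MM \/ N w by right.
  (* If [j <= l], then [a] is in the power [k - l] of [A]; combined with [b + z] in the power [l] of
     [B], this would force [M 0] or [N z]. *)
  have [jl|lj] := leqP j l; last by rewrite addn1; apply: mpow_le Bj.
  have [//|//] : M 0%MM \/ N z.
  apply/mixed; exists (k - l)%N, l; split=> //; first by rewrite subnK // ltnW.
  by apply: mpow_le Ai; rewrite -eqk leq_subLR addnC leq_add2r.
Qed.

(** If [r + s = i + j + 1], then [r > i] or [s > j], which puts a multiplier in [M] or [N].
    Conversely, a multiplier in [M] only reaches the power [i + 1] of [A], and [b] has to supply the
    other [j] factors; symmetrically for [N]. *)
Lemma witness_join (n m : nat) (A M : set 'X_{1..n}) (B N : set 'X_{1..m})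
    (i j : nat) (a : 'X_{1..n}) (b : 'X_{1..m}) :
  witness (mpow A i.+1) M a -> witness (mpow B j.+1) N b ->
  (M !=set0 -> mpow B j b) -> (N !=set0 -> mpow A i a) ->
  witness (mpow (@mfst n m @^-1` A `|` @msnd n m @^-1` B) (i + j).+1)
          (@mfst n m @^-1` M `|` @msnd n m @^-1` N) (mcat a b).
Proof.
move=> aW bW MB NA w; rewrite -[w]mcat_mfst_msnd mcatD mpow_add /setU /=.
rewrite mfst_mcat msnd_mcat; move: (mfst w) (msnd w) => u v {w}; split.
  move=> [r [s [rs Ar Bs]]]; have [ri|ir] := leqP r i.
    right; apply/bW; apply: mpow_le Bs.
    by rewrite -(leq_add2l r) rs -addSnnS -addSn leq_add2r ltnS.
  by left; apply/aW; apply: mpow_le Ar.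
move=> [Mu|Nv].
  exists i.+1, j; split=> //; first exact/aW.
  by apply: upset_mpow; apply: MB; exists u.
exists i, j.+1; split; [by rewrite addnS | | exact/bW].
by apply: upset_mpow; apply: NA; exists v.
Qed.

(** Since a multiple of an element of [A] carries [u] into the power [k + 1], [V] contains a
    variable; multiplying [u] by that variable and cancelling it costs one power. *)
Lemma witness_meets_pred (n : nat) (A : set 'X_{1..n}) (V : {set 'I_n})
    (k : nat) (u : 'X_{1..n}) :
  upset A -> witness (mpow A k.+1) (meets V) u -> A !=set0 -> mpow A k u.
Proof.
move=> upA uW [c Ac].
have Apow l : mpow A l (c *+ l)%MM.
  by elim: l => [|l IH] //; rewrite mulmS; apply: mpowS.
have [i iV _] : meets V (c *+ k.+1)%MM by apply/uW; rewrite addmC; apply: upset_mpow.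
apply: (mpow_pred (i := i)) => //; apply/uW; exists i => //.
by rewrite mnm1E eqxx.
Qed.

Lemma Ass_mspan (K : fieldType) (n : nat) (A M : set 'X_{1..n}) :
  upset A -> mprime M ->
  Ass (mspan K A) (mspan K M) <->
  prime_ideal (mspan K M) /\ witness A M !=set0.
Proof.
move=> upA prM; split=> [[prP [f /(witness_colon upA prM)[u _ uW]]]|[prP [u uW]]].
  by split=> //; exists u.
by split=> //; exists 'X_[u]; apply: colon_witness.
Qed.

(* [IJ_eq0] excludes the case where k >= 2 and exactly one of I, J is zero: for
   I = 0, J = (y), p = 0, q = (y), k = 2 the left-hand side is 1 and the
   right-hand side is 0. *)
Theorem theorem4p1 (K : fieldType) (n m : nat)
    (I : set {mpoly K[n]}) (J : set {mpoly K[m]})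
    (I_mono : monomial_ideal I) (I_proper : I <> setT)
    (J_mono : monomial_ideal J) (J_proper : J <> setT)
    (k : nat) (k_ge1 : (1 <= k)%N)
    (IJ_eq0 : (2 <= k)%N -> (I = [set 0] <-> J = [set 0]))
    (p : set {mpoly K[n]}) (q : set {mpoly K[m]})
    (p_prime : monomial_prime p) (q_prime : monomial_prime q)
    (pq_Ass : Ass (exp_ideal (add_ideal (ext_x m I) (ext_y n J)) k)
                  (add_ideal (ext_x m p) (ext_y n q))) :
  is_minimum
    [set (vnumber (exp_ideal I (k - l)) p + vnumber (exp_ideal J (l + 1)) q)%N
       | l in [set l : nat | [/\ (l < k)%N,
                                Ass (exp_ideal I (k - l)) p
                              & Ass (exp_ideal J (l + 1)) q]]]
    (vnumber (exp_ideal (add_ideal (ext_x m I) (ext_y n J)) k)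
             (add_ideal (ext_x m p) (ext_y n q))).
Proof.
have [[A upA eqI] [B upB eqJ]] := (monomial_idealP I_mono, monomial_idealP J_mono).
have [pP qP] := (proj1 p_prime, proj1 q_prime).
have [[V eqp] [W eqq]] := (monomial_primeP p_prime, monomial_primeP q_prime).
have prM := mprime_meets V; have prN := mprime_meets W.
have [[upM M0 _] [upN N0 _]] := (prM, prN).
subst I J p q; rewrite !ext_x_mspan // !ext_y_mspan // in pq_Ass *.
have up1 (D : set 'X_{1..n}) : upset D -> upset (@mfst n m @^-1` D).
  by move=> upD u v; rewrite /= mfstD; apply: upD.
have up2 (D : set 'X_{1..m}) : upset D -> upset (@msnd n m @^-1` D).
  by move=> upD u v; rewrite /= msndD; apply: upD.
rewrite !add_mspan ?exp_mspan in pq_Ass *; try by [apply: up1|apply: up2].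
have prMN := mprime_sum prM prN.
move: pq_Ass => /(Ass_mspan _ (@upset_mpow _ _ _) prMN)[_ exMN].
have [[c cW <-] minMN] := vnumber_witness K (@upset_mpow _ _ k) prMN exMN.
set D := [set _ | _ in _].
(* Joining witnesses of least degree for [p] and [q] gives a witness for [p + q] whose degree is the
   sum. *)
have leD : lbound D (mdeg c).
  move=> _ [l [lk + +] <-]; rewrite !exp_mspan.
  move=> /(Ass_mspan _ (@upset_mpow _ _ _) prM)[_ exM].
  move=> /(Ass_mspan _ (@upset_mpow _ _ _) prN)[_ exN].
  have [[a aW <-] _] := vnumber_witness K (@upset_mpow _ _ _) prM exM.
  have [[b bW <-] _] := vnumber_witness K (@upset_mpow _ _ _) prN exN.
  (* With [k = i + l + 1], the exponent [k - l] is the successor of [i], as joining requires. *)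
  rewrite -mdeg_mcat; have [i eqk] : exists i, k = (i + l).+1.
    by exists (k - l.+1)%N; rewrite -addnS subnK.
  apply: minMN; exists (mcat a b) => //.
  move: aW bW; rewrite eqk addn1 -addSn addnK addSn => aW bW.
  have neA_neB : (1 < k)%N -> (A !=set0 <-> B !=set0).
    move=> /IJ_eq0; rewrite !mspan_eq0 => AB.
    by split=> /set0P /eqP AB0; apply/set0P/eqP => /AB.
  apply: witness_join => // [[w Mw]|[w Nw]] {exM exN}.
    (* For [l = 0] the power of [B] is everything. Otherwise [k >= 2], and an element of [M] makes
       [A] nonempty, hence also [B]. *)
    case: l => [//|l] in lk eqk aW bW *.
    apply: witness_meets_pred bW _ => //; apply/neA_neB; first by rewrite eqk addnS.
    by apply: mpow_nonempty (proj2 (aW w) Mw).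
  case: i => [//|i] in eqk aW *.
  apply: witness_meets_pred aW _ => //; apply/neA_neB; first by rewrite eqk.
  by apply: mpow_nonempty (proj2 (bW w) Nw).
split=> //; move: cW minMN leD; rewrite -[c]mcat_mfst_msnd.
move: (mfst c) (msnd c) => a b cW minMN leD.
have [l [lk aW bW]] := witness_split M0 N0 cW.
have lD : D (vnumber (exp_ideal (mspan K A) (k - l)) (mspan K (meets V)) +
             vnumber (exp_ideal (mspan K B) (l + 1)) (mspan K (meets W)))%N.
  exists l => //; split; rewrite ?exp_mspan //.
    by apply/Ass_mspan => //; [apply: upset_mpow | split=> //; exists a].
  by apply/Ass_mspan => //; [apply: upset_mpow | split=> //; exists b].
move: (lD) => /leD; move: lD; set d := (_ + _)%N => lD led.
(* One inequality is [led]; for the other, the degrees of the witnesses [a] and [b] bound the two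
   v-numbers from above. *)
have -> // : mdeg (mcat a b) = d.
apply/eqP; rewrite eqn_leq; apply/andP; split; first exact: led.
rewrite mdeg_mcat /d !exp_mspan.
have [_ minM] := vnumber_witness K (@upset_mpow _ A _) prM (ex_intro _ a aW).
have [_ minN] := vnumber_witness K (@upset_mpow _ B _) prN (ex_intro _ b bW).
by apply: leq_add; [apply: minM; exists a | apply: minN; exists b].
Qed.
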